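(* Let $0<\alpha<1$, let $q$ be defined by $\frac1q=1-\alpha$, and let $\omega:\mathbb{Z}\to(0,\infty)$ be a discrete weight. Then $\omega\in\mathcal{A}(1,q)$ if and only if the discrete Riesz potential $I_\alpha$ is bounded from $l^1_\omega$ to $l^{q,weak}_{\omega^q}$, i.e., if and only if there exists a constant $C>0$ such that for every sequence $x\in l^1_\omega$ and every $a>0$, $$\Bigg(\sum_{\{k\in\mathbb{Z}:\,|I_\alpha x(k)|>a\}}\omega(k)^q\Bigg)^{1/q}\le \frac{C}{a}\sum_{k\in\mathbb{Z}}|x(k)|\,\omega(k).$$
   Context: For $m\in\mathbb{Z}$ and $N\in\mathbb{N}=\{0,1,2,\dots\}$, let $S_{m,N}:=\{k\in\mathbb{Z}:|k-m|\le N\}$, with cardinality $|S_{m,N}|=2N+1$. A discrete weight is a function $\omega:\mathbb{Z}\to(0,\infty)$. Weight class: $\omega\in\mathcal{A}(1,q)$ means $$\sup_{m\in\mathbb{Z},\,N\in\mathbb{N}}\Bigg(\frac1{|S_{m,N}|}\sum_{k\in S_{m,N}}\omega(k)^q\Bigg)^{1/q}\Bigg(\sup_{k\in S_{m,N}}\frac1{\omega(k)}\Bigg)<\infty.$$ Operator: for a real sequence $x=\{x(k)\}_{k\in\mathbb{Z}}$ and $0<\alpha<1$, $I_\alpha x(k):=\sum_{i\in\mathbb{Z}\setminus\{k\}}\frac{x(i)}{|k-i|^{1-\alpha}}$ for $k\in\mathbb{Z}$. As usual, boundedness of $I_\alpha$ on a space of sequences includes that $I_\alpha x$ is well defined (the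 series converges) for every $x$ in that space. Spaces: $l^1_\omega$ is the set of real sequences $x$ with $\|x\|_{l^1_\omega}=\sum_{k\in\mathbb{Z}}|x(k)|\omega(k)<\infty$. For a weight $v$, $l^{q,weak}_{v}$ is the set of real sequences $x$ with $\sup_{\lambda>0}\lambda\,[v(\{k\in\mathbb{Z}:|x(k)|>\lambda\})]^{1/q}<\infty$, where $v(E)=\sum_{k\in E}v(k)$. *)

(* Defs.v *)
From HB Require Import structures.
From mathcomp Require Import all_boot all_order all_algebra.
From mathcomp Require Import all_classical all_reals all_analysis.
Set Implicit Arguments.
Unset Strict Implicit.
Unset Printing Implicit Defensive.
Import Order.TTheory GRing.Theory Num.Theory.
Local Open Scope classical_set_scope.
Local Open Scope ring_scope.

Section Defs.
Context {R : realType}.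
Implicit Types (w x : int -> R) (al q : R).

Definition weight w := forall k, 0 < w k.

Definition dint (m : int) (N : nat) : set int := [set k | `|k - m| <= N%:Z].

(* [dint m N] has 2N + 1 elements, and being finite and nonempty it makes the
   real-valued [sup] below an honest supremum. *)
Definition A1q_const q w (m : int) (N : nat) : R :=
  ((2 * N + 1)%:R^-1 * \sum_(k \in dint m N) w k `^ q) `^ q^-1
  * sup [set (w k)^-1 | k in dint m N].

Definition A1q q w : Prop :=
  (ereal_sup [set (A1q_const q w mN.1 mN.2)%:E | mN in [set: int * nat]]
     < +oo)%E.

Definition l1norm w x : \bar R := \esum_(k in [set: int]) (`|x k| * w k)%:E.

Definition l1 w : set (int -> R) := [set x | (l1norm w x < +oo)%E].

Definition riesz_term al x (k i : int) : R :=
  x i / (`|k - i|%:~R `^ (1 - al)).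

(* The index set is unordered, so convergence of the series is unconditional,
   that is, absolute, convergence. *)
Definition riesz_cvg al x (k : int) : Prop :=
  summable [set i | i != k] (EFin \o riesz_term al x k).

(* [esum] only makes sense for nonnegative terms; the sum of an absolutely
   convergent real series is the sum of its positive part minus the sum of its
   negative part. *)
Definition riesz al x (k : int) : R :=
  fine (\esum_(i in [set i | i != k]) ((riesz_term al x k)^\+ i)%:E)
  - fine (\esum_(i in [set i | i != k]) ((riesz_term al x k)^\- i)%:E).

Definition wmass w (E : set int) : \bar R := \esum_(k in E) (w k)%:E.

End Defs.

(* Main.v *)
(* Put s = 1/q = 1 - al and mu = w^q.

   If w is in A(1,q), then every interval centred at i satisfies
   mu(S_{i,N}) <= A (2N+1) w(i)^q.  Hence, for a finite set F, splitting
   sum_{k in F} mu(k) |k-i|^{-s} at a radius comparable to mu(F) / w(i)^q bounds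
   it by K mu(F)^{1-s} w(i).  Summing over i against |x(i)| gives
   sum_{k in F} mu(k) |I_al x(k)| <= K mu(F)^{1-s} ||x||.  A singleton F yields
   the convergence of the series, and F contained in {|I_al x| > a} yields
   a mu(F)^s <= K ||x||.

   Conversely, for i in S_{m,N} the potential of the unit mass at i exceeds
   (2N+1)^{-s} on S_{m,N} minus i, so the weak-type bound gives
   mu(S_{m,N}) <= (C^q + 1) (2N+1) w(i)^q. *)
Require Import Defs.
From mathcomp Require Import all_boot all_order all_algebra finmap.
From mathcomp Require Import all_classical all_reals all_analysis.
From mathcomp Require Import ring lra zify.
Import Order.TTheory GRing.Theory Num.Theory.
Local Open Scope classical_set_scope.
Local Open Scope ring_scope.

(* [0 `^ s] is [0] for [s != 0] and [0^-1] is [0], so [kern s] vanishes at [0] and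
   the sums below need not exclude the diagonal. *)
Definition kern {R : realType} (s : R) (n : nat) : R := (n%:R `^ s)^-1.

(** Stated for duplicate-free lists inside the ball, so that it applies directly to any filtered
    piece of a finite set; [2 * n + 1] is the number of points of the ball. *)
Definition ball_growth {R : realType} (mu : int -> R) (B : R) (i : int) : Prop :=
  forall (n : nat) (G : seq int), uniq G -> all (fun k => `|k - i| <= n)%N G ->
    \sum_(k <- G) mu k <= B * (2 * n + 1)%:R.

Definition near_const {R : realType} (s : R) : R := 6 / (1 - 2^-1 `^ (1 - s)).

(** * Kernel sums for masses of linear growth around the pole *)

Section Kernel.
Context {R : realType} (s : R) (s_gt0 : 0 < s) (s_lt1 : s < 1).

Lemma kern_ge0 n : 0 <= kern s n.
Proof. by rewrite invr_ge0 powR_ge0. Qed.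

Lemma kern0 : kern s 0 = 0.
Proof. by rewrite /kern powR0 ?invr0 ?gt_eqF. Qed.

(** The contraction ratio of the halving recursion; [s < 1] makes it smaller than 1, so the
    recursion closes with a finite positive [near_const]. *)
Lemma half_powR_lt1 : 2^-1 `^ (1 - s) < 1 :> R.
Proof.
rewrite [ltRHS](_ : _ = 1 `^ (1 - s)); last by rewrite powR1.
by apply: gt0_ltr_powR; rewrite ?subr_gt0 ?nnegrE ?invr_ge0 ?ler0n
  ?invf_lt1 ?ltr1n.
Qed.

Lemma near_const_gt0 : 0 < near_const s.
Proof. by rewrite divr_gt0// subr_gt0 half_powR_lt1. Qed.

Lemma kern_le (x : R) n : 0 < x -> x <= n%:R -> kern s n <= (x `^ s)^-1.
Proof.
move=> x0 xn; rewrite /kern lef_pV2 ?posrE ?powR_gt0//; last exact: lt_le_trans xn.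
by apply: ge0_ler_powR; rewrite ?nnegrE ?(ltW s_gt0) ?(ltW x0)// (le_trans (ltW x0)).
Qed.

(* Strong induction on [n] by halving: the shell [n/2 < |k - i| <= n] contributes
   at most [6 B n^(1-s)], and [near_const] solves [D 2^-(1-s) + 6 = D]. *)
Lemma kern_sum_near (mu : int -> R) (B : R) (i : int) (n : nat) (G : seq int) :
  0 <= B -> (forall k, 0 <= mu k) -> ball_growth mu B i ->
  uniq G -> all (fun k => `|k - i| <= n)%N G ->
  \sum_(k <- G) mu k * kern s `|k - i|%N <= near_const s * B * n%:R `^ (1 - s).
Proof.
move=> B0 mu0 muB; have DB0 := mulr_ge0 (ltW near_const_gt0) B0.
elim/ltn_ind: n G => -[_|n IH] G uG /allP Gn.
  rewrite big_seq big1 => [|k /Gn]; first by rewrite mulr_ge0 ?powR_ge0.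
  by rewrite leqn0 => /eqP ->; rewrite kern0 mulr0.
set m := n.+1; set X := m%:R `^ (1 - s); set c := 2^-1 `^ (1 - s) : R.
rewrite (bigID (fun k => `|k - i| <= m./2)%N)/=.
have near : \sum_(k <- G | (`|k - i| <= m./2)%N) mu k * kern s `|k - i|%N
    <= near_const s * B * (c * X).
  rewrite -big_filter.
  have m2 : (m./2 < m)%N by rewrite /m; lia.
  apply: le_trans (IH _ m2 _ (filter_uniq _ uG) (filter_all _ _)) _.
  rewrite ler_wpM2l//.
  rewrite /c /X -powRM ?invr_ge0//.
  apply: ge0_ler_powR; rewrite ?nnegrE ?subr_ge0 ?(ltW s_lt1) ?mulr_ge0 ?invr_ge0//.
  rewrite ler_pdivlMl// -natrM ler_nat; lia.
have far : \sum_(k <- G | ~~ (`|k - i| <= m./2)%N) mu k * kern s `|k - i|%N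
    <= 6 * B * X.
  rewrite -big_filter.
  set G' := [seq k <- G | ~~ (`|k - i| <= m./2)%N].
  (* An integer distance above [m./2] is at least m/2 for either parity of [m], so the kernel on the
     shell is at most (m/2)^-s. *)
  have : \sum_(k <- G') mu k * kern s `|k - i|%N
         <= \sum_(k <- G') mu k * ((2^-1 * m%:R) `^ s)^-1.
    rewrite [leLHS]big_seq [leRHS]big_seq; apply: ler_sum => k.
    rewrite mem_filter -ltnNge => /andP[mk _].
    rewrite ler_wpM2l// kern_le// ?mulr_gt0// ler_pdivrMl// -natrM ler_nat; lia.
  move=> /le_trans; apply; rewrite -mulr_suml powRM ?invr_ge0//.
  (* The ball of radius [m] has 2m + 1 <= 3m points as m >= 1. This 3, times the factor 2^s <= 2
     coming from (m/2)^-s, gives the 6. *)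
  have G'm : \sum_(k <- G') mu k <= 3 * B * m%:R.
    apply: (le_trans (muB m G' (filter_uniq _ uG) _)).
      by apply/allP => k; rewrite mem_filter => /andP[_ /Gn].
    rewrite -mulrA mulrCA ler_wpM2l// -natrM ler_nat; lia.
  have XE : m%:R = X * m%:R `^ s.
    by rewrite /X -powRD ?subrK ?powRr1// oner_eq0.
  have s2 : (2^-1 : R) <= 2^-1 `^ s.
    by apply: ger1_powR; rewrite ?(ltW s_lt1)// invr_gt0 ltr0n invf_le1 ?ler1n.
  rewrite ler_pdivrMr ?mulr_gt0 ?powR_gt0//.
  apply: (le_trans G'm); rewrite [in leLHS]XE.
  have BX : 0 <= B * X * m%:R `^ s by rewrite !mulr_ge0 ?powR_ge0.
  nra.
apply: le_trans (lerD near far) _.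
have c1 : 1 - c != 0 by rewrite gt_eqF// subr_gt0 half_powR_lt1.
rewrite le_eqVlt; apply/orP; left; apply/eqP.
rewrite /near_const -/c; field; exact: c1.
Qed.

Lemma kern_sum_le (mu : int -> R) (B : R) (i : int) (F : seq int) :
  0 < B -> (forall k, 0 <= mu k) -> ball_growth mu B i -> uniq F ->
  \sum_(k <- F) mu k * kern s `|k - i|%N
    <= (near_const s + 1) * B `^ s * (\sum_(k <- F) mu k) `^ (1 - s).
Proof.
move=> B0 mu0 muB uF; set M := \sum_(k <- F) mu k.
have M0 : 0 <= M by apply: sumr_ge0.
(* The radius [mu F / B] balances the near and far contributions. *)
have /andP[rle rlt] := truncn_itv (divr_ge0 M0 (ltW B0)).
set r := Num.trunc (M / B) in rle rlt.
(* The exponents add up to 1, which is nonzero, so the splitting also holds for M = 0. *)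
have ME : M = M `^ (1 - s) * M `^ s.
  by rewrite -powRD ?subrK ?powRr1// oner_eq0.
rewrite (bigID (fun k => `|k - i| <= r)%N)/=.
have near : \sum_(k <- F | (`|k - i| <= r)%N) mu k * kern s `|k - i|%N
    <= near_const s * (B `^ s * M `^ (1 - s)).
  rewrite -big_filter.
  apply: le_trans (kern_sum_near _ _ _ _ _ (ltW B0) mu0 muB
    (filter_uniq _ uF) (filter_all _ _)) _.
  rewrite -mulrA ler_wpM2l ?(ltW near_const_gt0)//.
  (* The near bound is B r^(1-s), and r <= M / B turns it into this quantity. *)
  have -> : B `^ s * M `^ (1 - s) = B * (M / B) `^ (1 - s).
    rewrite powRM ?invr_ge0 ?(ltW B0)// -(@powR_inv1 _ B) ?(ltW B0)//.
    rewrite -powRrM mulN1r [in RHS]mulrCA -[B in RHS]powRr1 ?(ltW B0)//.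
    rewrite -powRrM mul1r mulrC -powRD; last by rewrite (gt_eqF B0) implybT.
    by congr (_ * _ `^ _); lra.
  rewrite ler_wpM2l ?(ltW B0)//.
  apply: ge0_ler_powR; rewrite ?nnegrE ?subr_ge0 ?(ltW s_lt1)//.
  by rewrite divr_ge0 ?(ltW B0).
have far : \sum_(k <- F | ~~ (`|k - i| <= r)%N) mu k * kern s `|k - i|%N
    <= B `^ s * M `^ (1 - s).
  (* Beyond [r] the distance is at least [r.+1], which exceeds M / B; the whole mass [M] then serves
     as a bound for the far mass. *)
  apply: (@le_trans _ _ (M * (r.+1%:R `^ s)^-1)).
    rewrite /M mulr_suml [leRHS](bigID (fun k => `|k - i| <= r)%N)/=.
    rewrite -[leLHS]add0r lerD//.
      by apply: sumr_ge0 => k _; rewrite mulr_ge0 ?invr_ge0 ?powR_ge0.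
    apply: ler_sum => k; rewrite -ltnNge => rk.
    by rewrite ler_wpM2l// kern_le ?ltr0n// ler_nat.
  rewrite ler_pdivrMr ?powR_gt0// [in leLHS]ME [leRHS]mulrAC -powRM ?(ltW B0)//.
  rewrite mulrC ler_wpM2r ?powR_ge0//.
  apply: ge0_ler_powR; rewrite ?nnegrE ?(ltW s_gt0) ?mulr_ge0 ?(ltW B0)//.
  by rewrite mulrC -ler_pdivrMr// ltW.
apply: le_trans (lerD near far) _; rewrite -mulrA mulrDl mul1r//.
Qed.

End Kernel.

(** * Finite and unordered sums of nonnegative terms *)

Section Sums.
Context {R : realType} {T : choiceType}.
Implicit Types (S : set T) (F : seq T).

(** Links the list form of sums to the set form: up to order, [F] is a part of the enumeration of
    [S], and the remaining terms are nonnegative. *)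
Lemma ler_sum_uniq_fsbig S F (f : T -> R) :
  finite_set S -> (forall k, 0 <= f k) -> uniq F -> [set` F] `<=` S ->
  \sum_(k <- F) f k <= \sum_(k \in S) f k.
Proof.
move=> finS f0 uF FS.
rewrite fsbig_finite// [leRHS](bigID (mem F))/= -[leLHS]addr0 lerD ?sumr_ge0//.
rewrite -[leRHS]big_filter [leRHS](perm_big F)//.
apply: uniq_perm => // [|k]; first exact/filter_uniq/fset_uniq.
rewrite mem_filter; case: (boolP (k \in F)) => //= kF.
by rewrite in_fset_set// mem_set//; exact: FS.
Qed.

Lemma esumZl S (c : R) (f : T -> \bar R) :
  0 <= c -> (forall i, (0 <= f i)%E) ->
  (\esum_(i in S) (c%:E * f i) = c%:E * \esum_(i in S) f i)%E.
Proof.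
move=> c0 f0; rewrite /esum -ereal_supZl//; last first.
  by apply/set0P; exists (\sum_(x \in set0) f x)%R, set0 => //; exact: fsets_set0.
rewrite image_comp; congr ereal_sup; apply: eq_imagel => A _ /=.
by rewrite ge0_mule_fsumr.
Qed.

Lemma esum_single S t (f : T -> \bar R) :
  S t -> (0 <= f t)%E -> (forall i, i != t -> f i = 0%E) ->
  (\esum_(i in S) f i = f t)%E.
Proof.
move=> St ft0 f0; rewrite (esumID [set t])//; last first.
  by move=> i _; have [->|/f0 ->] := eqVneq i t.
rewrite setIC [X in esum X]setIidl ?esum_set1// => [|_ ->//].
by rewrite esum1 ?adde0// => i [_ /eqP /f0].
Qed.

End Sums.

Lemma dint_finite m N : finite_set (dint m N).
Proof.
apply: (@sub_finite_set _ _ [set` [seq m - N%:Z + j%:Z | j <- iota 0 (2 * N + 1)]]) => //.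
move=> k /=; rewrite /dint/= => kN; apply/mapP; exists (absz (k - m + N%:Z)).
  rewrite mem_iota; lia.
lia.
Qed.

Lemma dint_center m N : dint m N m.
Proof. by rewrite /dint/= subrr normr0. Qed.

(** * The Riesz potential and its nonnegative majorant *)

Section Riesz.
Context {R : realType}.
Implicit Types (al q s : R) (w x : int -> R).

(** Lives in the extended reals, so it can be estimated before the series for the potential is known
    to converge. *)
Definition abs_riesz s x (k : int) : \bar R :=
  \esum_(i in [set: int]) (`|x i| * kern s `|k - i|%N)%:E.

Lemma riesz_termE al x k i :
  riesz_term al x k i = x i * kern (1 - al) `|k - i|%N.
Proof. by rewrite /riesz_term /kern natr_absz. Qed.

Lemma abs_riesz_ub al x k :
  (\esum_(i in [set i | i != k]) `|(EFin \o riesz_term al x k) i|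
    <= abs_riesz (1 - al) x k)%E.
Proof.
rewrite esum_mkcond; apply: le_esum => i _.
have k0 := kern_ge0 (1 - al) `|k - i|%N.
case: ifPn => _ /=; last by rewrite lee_fin mulr_ge0.
by rewrite lee_fin riesz_termE normrM (ger0_norm k0).
Qed.

Lemma abs_riesz_cvg al x k : (abs_riesz (1 - al) x k < +oo)%E -> riesz_cvg al x k.
Proof. exact/le_lt_trans/abs_riesz_ub. Qed.

(** With S the sum of the absolute values of the terms, the positive and the negative part both have
    sums in [0, S], so their difference lies in [-S, S]. Convergence makes S finite, so [fine] loses
    nothing. *)
Lemma riesz_le al x k : riesz_cvg al x k ->
  (`|riesz al x k|%:E <= abs_riesz (1 - al) x k)%E.
Proof.
move=> cx; apply: le_trans (abs_riesz_ub al x k).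
set S := (X in (_ <= X)%E).
have Sfin : S \is a fin_num by rewrite -summableE.
have bound (f : int -> R) : (forall i, 0 <= f i <= `|riesz_term al x k i|) ->
    0 <= fine (\esum_(i in [set i | i != k]) (f i)%:E) <= fine S.
  move=> fP; have f0 : (0 <= \esum_(i in [set i | i != k]) (f i)%:E)%E.
    by apply: esum_ge0 => i _; rewrite lee_fin; case/andP: (fP i).
  have fS : (\esum_(i in [set i | i != k]) (f i)%:E <= S)%E.
    by apply: le_esum => i _; rewrite /= lee_fin; case/andP: (fP i).
  rewrite fine_ge0//= fine_le// fin_numE gt_eqF ?(lt_le_trans _ f0)//=.
  by rewrite lt_eqF// (le_lt_trans fS)// ltey_eq Sfin.
have pos : forall i, 0 <= (riesz_term al x k)^\+ i <= `|riesz_term al x k i|.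
  by move=> i; rewrite funrpos_ge0 /funrpos ge_max normr_ge0 ler_norm.
have neg : forall i, 0 <= (riesz_term al x k)^\- i <= `|riesz_term al x k i|.
  by move=> i; rewrite funrneg_ge0 /funrneg ge_max normr_ge0 -normrN ler_norm.
have /andP[p0 pS] := bound _ pos; have /andP[n0 nS] := bound _ neg.
rewrite -(fineK Sfin) lee_fin /riesz ler_norml; apply/andP; split; lra.
Qed.

End Riesz.

(** * The exponents [s] and [q] as mutually inverse powers *)

Section Main.
Context {R : realType} (al q : R) (w : int -> R).
Context (al_gt0 : 0 < al) (al_lt1 : al < 1) (qE : 1 / q = 1 - al).
Context (w_weight : weight w).

Let s : R := 1 - al.
Let mu (k : int) : R := w k `^ q.

Let s_gt0 : 0 < s. Proof. by rewrite subr_gt0. Qed.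
Let s_lt1 : s < 1. Proof. by rewrite ltrBlDr ltrDl. Qed.
Let q_inv : q^-1 = s. Proof. by rewrite -div1r. Qed.
Let q_gt0 : 0 < q. Proof. by rewrite -invr_gt0 q_inv. Qed.
Let sqE : s * q = 1. Proof. by rewrite -q_inv mulVf ?gt_eqF. Qed.
Let mu_gt0 k : 0 < mu k. Proof. exact/powR_gt0/w_weight. Qed.
Let mu_ge0 k : 0 <= mu k. Proof. exact/ltW. Qed.

Let powR_sK (y : R) : 0 <= y -> (y `^ s) `^ q = y.
Proof. by move=> y0; rewrite -powRrM sqE powRr1. Qed.
Let powR_qK (y : R) : 0 <= y -> (y `^ q) `^ s = y.
Proof. by move=> y0; rewrite -powRrM mulrC sqE powRr1. Qed.

Lemma powR_le_swap (y z : R) : 0 <= y -> 0 <= z -> (y `^ s <= z) = (y <= z `^ q).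
Proof.
move=> y0 z0; apply/idP/idP => yz.
  rewrite -(powR_sK _ y0); apply: ge0_ler_powR; rewrite ?nnegrE ?powR_ge0 ?(ltW q_gt0)//.
rewrite -(powR_qK _ z0); apply: ge0_ler_powR; rewrite ?nnegrE ?powR_ge0 ?(ltW s_gt0)//.
Qed.

(** * From the weight class to the weak-type bound *)

Lemma A1q_const_bounded : A1q q w -> exists2 M : R, 0 < M &
  forall m N, A1q_const q w m N <= M.
Proof.
rewrite /A1q; set S := ereal_sup _ => Soo.
have le m N : ((A1q_const q w m N)%:E <= S)%E.
  by apply: ereal_sup_ubound; exists (m, N).
exists (Num.max 1 (fine S)) => [|m N]; first by rewrite lt_max ltr01.
have Sfin : S \is a fin_num.
  by rewrite fin_real// Soo (lt_le_trans _ (le 0 0%N)) ?ltNyr.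
by rewrite le_max; apply/orP; right; rewrite -lee_fin fineK.
Qed.

(** Needed to compare an element with the real-valued [sup]: each reciprocal is one term of a finite
    sum of nonnegative terms. *)
Lemma inv_weight_has_ubound m N : has_ubound [set (w k)^-1 | k in dint m N].
Proof.
exists (\sum_(k \in dint m N) (w k)^-1) => _ [k kS <-].
rewrite -[leLHS](big_seq1 +%R k (fun k => (w k)^-1)).
apply: ler_sum_uniq_fsbig => //; first exact: dint_finite.
- by move=> j; rewrite invr_ge0 ltW.
- by move=> j /=; rewrite inE => /eqP ->.
Qed.

(** The centre [i] belongs to its own interval, so 1 / w(i) is at most the supremum in the weight
    condition; raising the resulting bound to the power [q] gives A = M^q. *)
Lemma A1q_ball_growth : A1q q w -> exists2 A : R, 0 < A &
  forall i, ball_growth mu (A * mu i) i.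
Proof.
move=> /A1q_const_bounded[M M0 AM]; exists (M `^ q) => [|i n G uG Gn].
  exact: powR_gt0.
have GS : \sum_(k <- G) mu k <= \sum_(k \in dint i n) mu k.
  apply: ler_sum_uniq_fsbig => //; first exact: dint_finite.
  by move=> k /= /(allP Gn)/= kn; rewrite /dint/=; lia.
apply: le_trans GS _; move: (AM i n); rewrite /A1q_const q_inv.
set S := \sum_(k \in _) _; set c : R := (2 * n + 1)%:R => AMi.
have c0 : 0 < c by rewrite ltr0n addn1.
have S0 : 0 <= S by apply: fsumr_ge0 => k _; exact: mu_ge0.
have cS0 : 0 <= c^-1 * S by rewrite mulr_ge0 ?invr_ge0 ?(ltW c0).
have wsup : (w i)^-1 <= sup [set (w k)^-1 | k in dint i n].
  apply: ub_le_sup; first exact: inv_weight_has_ubound.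
  by exists i => //; exact: dint_center.
have : (c^-1 * S) `^ s * (w i)^-1 <= M.
  by apply: le_trans AMi; rewrite ler_wpM2l ?powR_ge0.
have Mw0 : 0 <= M * w i by rewrite mulr_ge0 ?(ltW M0) ?(ltW (w_weight i)).
rewrite ler_pdivrMr// powR_le_swap//.
by rewrite powRM ?(ltW M0) ?(ltW (w_weight i))// ler_pdivrMl// mulrC.
Qed.

(* The weak-[l^q] bound for the kernel with pole at [i], in the form
   [\sum_F mu K <= C (mu F)^(1 - 1/q)] that is linear in the kernel, so that it
   can be summed over [i]. *)
Lemma A1q_kern_sum : A1q q w -> exists2 K : R, 0 < K &
  forall i F, uniq F -> \sum_(k <- F) mu k * kern s `|k - i|%N
                        <= K * (\sum_(k <- F) mu k) `^ (1 - s) * w i.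
Proof.
move=> /A1q_ball_growth[A A0 muA]; exists ((near_const s + 1) * A `^ s).
  by rewrite mulr_gt0 ?powR_gt0// addr_gt0// near_const_gt0.
move=> i F uF.
apply: le_trans
  (kern_sum_le _ s_gt0 s_lt1 _ _ _ _ (mulr_gt0 A0 (mu_gt0 i)) mu_ge0 (muA i) uF) _.
rewrite powRM ?(ltW A0)// powR_qK ?(ltW (w_weight i))//.
by rewrite le_eqVlt; apply/orP; left; apply/eqP; ring.
Qed.

(** Tonelli: the finite sum over [F] and the unordered sum over [i] are exchanged, and the bound for
    each pole is then weighted by |x(i)|. *)
Lemma A1q_abs_riesz : A1q q w -> exists2 K : R, 0 < K &
  forall x F, uniq F ->
    (\sum_(k <- F) (mu k)%:E * abs_riesz s x k
      <= (K * (\sum_(k <- F) mu k) `^ (1 - s))%:E * l1norm w x)%E.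
Proof.
move=> /A1q_kern_sum[K K0 Kle]; exists K => // x F uF.
have xk0 k i : (0 <= (`|x i| * kern s `|k - i|%N)%:E)%E.
  by rewrite lee_fin mulr_ge0 ?kern_ge0.
have -> : (\sum_(k <- F) (mu k)%:E * abs_riesz s x k =
    \esum_(i in [set: int])
      \sum_(k <- F) (mu k)%:E * (`|x i| * kern s `|k - i|%N)%:E)%E.
  rewrite esum_sum => [|i k _ _]; last by rewrite mule_ge0// lee_fin.
  by apply: eq_bigr => k _; rewrite esumZl.
rewrite /l1norm -esumZl ?mulr_ge0 ?powR_ge0 ?(ltW K0)//; last first.
  by move=> i; rewrite lee_fin mulr_ge0// ltW.
apply: le_esum => i _; under eq_bigr do rewrite -EFinM mulrCA.
rewrite sumEFin -EFinM lee_fin -mulr_sumr mulrCA ler_wpM2l//.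
exact: Kle.
Qed.

Lemma A1q_weak_type : A1q q w ->
  (forall x, l1 w x -> forall k, riesz_cvg al x k) /\
  exists C : R, 0 < C /\
    forall x, l1 w x -> forall a : R, 0 < a ->
      (poweR (wmass mu [set k | (a < `|riesz al x k|)%R]) (1 / q)%R
        <= (C / a)%:E * l1norm w x)%E.
Proof.
move=> /A1q_abs_riesz[K K0 Kle].
have cvg x : l1 w x -> forall k, riesz_cvg al x k.
  (* For the singleton [F], finiteness of mu(k) times the majorant forces the majorant to be finite,
     since mu(k) > 0. *)
  move=> lx k; apply: abs_riesz_cvg; have := Kle x [:: k] isT.
  rewrite !big_seq1 => kle.
  have muT : ((mu k)%:E * abs_riesz s x k < +oo)%E.
    apply: le_lt_trans kle _; rewrite lte_mul_pinfty//.
    by rewrite lee_fin mulr_ge0 ?powR_ge0 ?ltW.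
  rewrite ltey; apply: contraTneq muT => ->.
  by rewrite gt0_muley ?lte_fin// ltxx.
split=> //; exists K; split=> // x lx a a0.
have n0 : (0 <= l1norm w x)%E.
  by apply: esum_ge0 => i _; rewrite lee_fin mulr_ge0// ltW.
have nfin : l1norm w x \is a fin_num.
  by rewrite ge0_fin_numE.
move: (Kle x) => {}Kle; rewrite qE -/s.
rewrite -(fineK nfin) in Kle *; set n := fine _ in Kle *.
have nn0 : 0 <= n by rewrite fine_ge0.
have Kn0 : 0 <= K / a * n by rewrite !mulr_ge0 ?invr_ge0 ?(ltW K0) ?(ltW a0).
set E := [set k | _].
have mE : (wmass mu E <= ((K / a * n) `^ q)%:E)%E.
  (* The mass of [E] is a supremum over finite subsets, so [M] below is a real number and powers of
     it can be cancelled. *)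
  apply: ge_ereal_sup => _ [F [finF FE] <-].
  rewrite fsbig_finite//= sumEFin lee_fin; set M := \sum_(_ <- _) _.
  have M0 : 0 <= M by apply: sumr_ge0 => k _; exact: mu_ge0.
  have aM : a * M <= K * M `^ (1 - s) * n.
    rewrite -lee_fin EFinM; apply: le_trans (Kle _ (fset_uniq (fset_set F))).
    rewrite /M -sumEFin ge0_sume_distrr => [|k _]; last by rewrite lee_fin.
    rewrite big_seq [leRHS]big_seq; apply: lee_sum => k.
    rewrite in_fset_set// inE => /FE ak; rewrite muleC lee_pmul2l ?lte_fin//=.
    by apply: le_trans (riesz_le _ _ _ (cvg _ lx k)); rewrite lee_fin ltW.
  (* The claim M^s <= (K / a) n follows from [aM] by cancelling M^(1-s), which requires M > 0; for M
     = 0 the left side is 0. *)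
  rewrite -powR_le_swap//; have [->|Mn0] := eqVneq M 0.
    by rewrite powR0 ?gt_eqF.
  have {Mn0}M0 : 0 < M by rewrite lt_neqAle eq_sym Mn0.
  have Ms : 0 < M `^ (1 - s) by rewrite powR_gt0.
  rewrite mulrAC ler_pdivlMr// -(ler_pM2r Ms) mulrAC -powRD; last first.
    by rewrite (gt_eqF M0) implybT.
  by rewrite addrC subrK powRr1 ?(ltW M0)// mulrC [leRHS]mulrAC.
apply: (@le_trans _ _ (poweR ((K / a * n) `^ q)%:E s)).
  apply: gt0_ler_poweR; rewrite ?(ltW s_gt0)// in_itv/= leey andbT.
    by apply: esum_ge0 => k _; rewrite lee_fin.
  by rewrite lee_fin powR_ge0.
by rewrite poweR_EFin powR_qK// EFinM.
Qed.

(** * From the weak-type bound to the weight class, by testing on point masses *)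

Let delta (i0 i : int) : R := (i == i0)%:R.

Lemma l1norm_delta i0 : l1norm w (delta i0) = (w i0)%:E.
Proof.
rewrite /l1norm (@esum_single _ _ _ i0)//.
- by rewrite /delta eqxx normr1 mul1r.
- by rewrite lee_fin mulr_ge0// ltW.
- by move=> i /negbTE ii0; rewrite /delta ii0 normr0 mul0r.
Qed.

Lemma riesz_delta i0 k : k != i0 -> riesz al (delta i0) k = kern s `|k - i0|%N.
Proof.
move=> ki0; rewrite /riesz [X in _ - fine X]esum1 ?subr0 => [|i _]; last first.
  congr EFin; rewrite /funrneg riesz_termE; apply/max_idPr.
  by rewrite oppr_le0 mulr_ge0 ?kern_ge0// ler0n.
rewrite (@esum_single _ _ _ i0)/=; first last.
- move=> i /negbTE ii0; congr EFin.
  by rewrite /funrpos riesz_termE /delta ii0 mul0r maxxx.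
- by rewrite lee_fin funrpos_ge0.
- by rewrite eq_sym.
rewrite /funrpos riesz_termE /delta eqxx mul1r; apply/max_idPl.
exact: kern_ge0.
Qed.

Lemma weak_type_A1q (C : R) : 0 < C ->
  (forall x, l1 w x -> forall a : R, 0 < a ->
      (poweR (wmass mu [set k | (a < `|riesz al x k|)%R]) (1 / q)%R
        <= (C / a)%:E * l1norm w x)%E) ->
  A1q q w.
Proof.
move=> C0 weak.
(* The s-th root of the constant in [key]. *)
set Q := (C `^ q + 1) `^ s.
suff bound m N : A1q_const q w m N <= Q.
  apply: (@le_lt_trans _ _ Q%:E); last exact: ltry.
  by apply: ge_ereal_sup => _ [[m N] _ <-]; rewrite lee_fin bound.
rewrite /A1q_const q_inv; set S := \sum_(k \in _) _; set c : R := _%:R.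
have c0 : 0 < c by rewrite ltr0n addn1.
have finS := dint_finite m N.
(* Every point of the interval is tested, so that the supremum of the reciprocals can be taken at
   the end. The weak-type bound controls the interval without [i]; the summand 1 pays for mu(i)
   itself, using c >= 1. *)
have key i : dint m N i -> S <= (C `^ q + 1) * c * mu i.
  move=> Si; rewrite /S (fsbigD1 i)//= -/(mu i).
  set D := \sum_(k \in _) _.
  have D0 : 0 <= D by apply: fsumr_ge0 => k _; exact: mu_ge0.
  have cs0 : 0 < c `^ s by exact: powR_gt0.
  have a0 : 0 < (c `^ s)^-1 by rewrite invr_gt0.
  have li : l1 w (delta i) by rewrite /l1/= l1norm_delta ltry.
  have := weak _ li _ a0; rewrite l1norm_delta invrK qE -/s -EFinM.
  set E := [set k | _] => weaki.
  have DE : (D%:E <= wmass mu E)%E.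
    apply: esum_ge; exists (dint m N `\ i).
    2: by rewrite fsumEFin//; exact: finite_setD.
    split; first exact: finite_setD.
    move=> k [kS /eqP ki]; rewrite /E/= riesz_delta// ger0_norm ?kern_ge0//.
    (* Two distinct points of the interval are at distance between 1 and 2N < c, so the potential
       strictly exceeds the level c^-s. *)
    have ki0 : (0 < `|k - i|)%N by lia.
    rewrite /kern ltf_pV2 ?posrE ?powR_gt0 ?ltr0n ?addn1//.
    apply: gt0_ltr_powR; rewrite ?nnegrE ?ler0n// ltr_nat.
    by move: kS Si; rewrite /dint/=; lia.
  have : D `^ s <= C * c `^ s * w i.
    rewrite -lee_fin; apply: le_trans weaki; rewrite -poweR_EFin.
    apply: gt0_ler_poweR; [exact: ltW | | | exact: DE]; rewrite in_itv/= leey andbT.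
      by rewrite lee_fin.
    by apply: esum_ge0 => k _; rewrite lee_fin.
  have wi0 := ltW (w_weight i); have Cc0 : 0 <= C * c `^ s by rewrite mulr_ge0 ?ltW.
  have Ccw0 := mulr_ge0 Cc0 wi0.
  rewrite powR_le_swap// powRM// powRM ?(ltW C0) ?(ltW cs0)//.
  rewrite powR_sK ?(ltW c0)// -/(mu i) => DC.
  have c1 : 1 <= c by rewrite ler1n addn1.
  have := mu_gt0 i; nra.
have S0 : 0 < S.
  rewrite /S (fsbigD1 m)//=; last exact: dint_center.
  by rewrite ltr_pwDl ?mu_gt0//; apply: fsumr_ge0 => k _; exact: mu_ge0.
have avg0 : 0 < (c^-1 * S) `^ s by rewrite powR_gt0// mulr_gt0 ?invr_gt0.
(* Dividing by the positive average reduces the bound on the supremum to one on each 1 / w(i), which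
   is the s-th root of [key]. *)
rewrite mulrC -ler_pdivlMr//; apply: ge_sup => [|_ [i Si <-]].
  by exists (w m)^-1, m => //; exact: dint_center.
have wi0 := w_weight i.
rewrite ler_pdivlMr// mulrC ler_pdivrMr//.
rewrite -[w i](powR_qK _ (ltW wi0)) /Q -powRM ?addr_ge0 ?powR_ge0//.
apply: ge0_ler_powR; rewrite ?nnegrE ?(ltW s_gt0) ?mulr_ge0 ?addr_ge0 ?powR_ge0
  ?invr_ge0 ?(ltW c0) ?(ltW S0)//.
by rewrite ler_pdivrMl// mulrCA mulrA key.
Qed.

End Main.

Theorem theorem3p5 (R : realType) (al q : R) (w : int -> R)
  (al_gt0 : 0 < al) (al_lt1 : al < 1) (qE : 1 / q = 1 - al)
  (w_weight : weight w) :
  A1q q w <->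
  ((forall x : int -> R, l1 w x -> forall k : int, riesz_cvg al x k) /\
   exists C : R, 0 < C /\
     forall x : int -> R, l1 w x -> forall a : R, 0 < a ->
       (poweR (wmass (fun k => (w k `^ q)%R) [set k | (a < `|riesz al x k|)%R])
              (1 / q)%R
        <= (C / a)%:E * l1norm w x)%E).
Proof.
split=> [wA|[_ [C [C0 weak]]]]; first exact: A1q_weak_type.
exact: (weak_type_A1q al q w al_gt0 al_lt1 qE w_weight C C0 weak).
Qed.
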